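(* Let $\{\mathcal{G}_N\}$ be a family of connected, undirected, weighted graphs, where $\mathcal{G}_N=\{\mathcal{V}_N,\mathcal{E}_N\}$ has $N=|\mathcal{V}_N|$ nodes and the network size $N$ increases to infinity along the family. Suppose that there are constants $q$ and $0<w_{\min}\le w_{\max}<\infty$, independent of $N$, such that in every graph $\mathcal{G}_N$ of the family each node $i\in\mathcal{V}_N$ has at most $q$ neighbors, $|\mathcal{N}_i|\le q$, and each edge weight satisfies $w_{\min}\le w_{ij}\le w_{\max}$ for all $(i,j)\in\mathcal{E}_N$. Suppose further that the node set of every graph $\mathcal{G}_N$ in the family can be partitioned into three disjoint sets $X_1,X_2,X_3$ (depending on $N$) with $X_1\cup X_2\cup X_3=\mathcal{V}_N$ and sizes $|X_1|=N_1$, $|X_2|=N_2$, $|X_3|=N_3$, such that each node in $X_2$ is connected by an edge to at least one node in $X_1$ and to at least one node in $X_3$, no edge connects a node of $X_1$ to a node of $X_3$, and $$\frac{N_2}{N_1}\rightarrow 0 \quad\text{and}\quad \frac{N_2}{N_3}\rightarrow 0 \quad\text{as } N\rightarrow\infty .$$ Then $\lambda_2(\mathcal{G}_N)\rightarrow 0$ as $N\rightarrow\infty$, where $\lambda_2(\mathcal{G}_N)$ is the algebraic connectivity of $\mathcal{G}_N$.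
   Context: All graphs are finite, simple (no self-loops), undirected and connected, and each edge $(i,j)$ carries a weight $w_{ij}=w_{ji}>0$ (with $w_{ij}=0$ if $i\ne j$ and $(i,j)$ is not an edge). $\mathcal{N}_i$ denotes the set of neighbors of node $i$. The weighted graph Laplacian $L$ of a graph on $N$ nodes is the symmetric $N\times N$ matrix with $L_{ii}=\sum_{k\ne i}w_{ik}$ and $L_{ij}=-w_{ij}$ for $i\neq j$. Its eigenvalues are ordered as $0=\lambda_1<\lambda_2\le\dots\le\lambda_N$; the smallest non-zero eigenvalue $\lambda_2(\mathcal{G})$ is called the algebraic connectivity of $\mathcal{G}$. A graph family $\{\mathcal{G}_N\}$ is a sequence of graphs in which the network size $N$ is increasing. The sets $X_1,X_2,X_3$ need not induce connected subgraphs. *)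

(* Defs.v *)
From HB Require Import structures.
From mathcomp Require Import all_boot all_order all_algebra.
From mathcomp Require Import all_classical all_reals all_analysis.
From mathcomp Require Import complex polyrcf.

Set Implicit Arguments.
Unset Strict Implicit.
Unset Printing Implicit Defensive.

Import Order.TTheory GRing.Theory Num.Theory.
Import numFieldNormedType.Exports.

Local Open Scope classical_set_scope.
Local Open Scope ring_scope.

(* The diagonal values [weight i i] are left unspecified: nothing below
   depends on them. *)
Record wgraph (R : realType) (n : nat) := WGraph {
  edge : rel 'I_n;
  edge_sym : symmetric edge;
  edge_irr : irreflexive edge;
  weight : 'I_n -> 'I_n -> R;
  weight_sym : forall i j, weight i j = weight j i;
  weight_gt0 : forall i j, edge i j -> 0 < weight i j;
  weight_eq0 : forall i j, i != j -> ~~ edge i j -> weight i j = 0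
}.

Section WeightedGraph.
Variables (R : realType) (n : nat).
Implicit Types G : wgraph R n.

Definition graph_connected G : Prop := forall i j, connect (edge G) i j.

Definition neighbors G (i : 'I_n) : {set 'I_n} := [set j | edge G i j]%SET.

Definition laplacian G : 'M[R]_n :=
  \matrix_(i, j) if i == j then \sum_(k < n | k != i) weight G i k
                 else - weight G i j.

Definition nonzero_eigenvalues G : set R :=
  [set a | eigenvalue (laplacian G) a /\ a != 0].

(* For a connected graph on at least two nodes this infimum is a minimum, see
   [algebraic_connectivityP]. The value on a single node is junk. *)
Definition algebraic_connectivity G : R := inf (nonzero_eigenvalues G).

Lemma laplacian_sym G : (laplacian G)^T = laplacian G.
Proof.
apply/matrixP => i j; rewrite !mxE eq_sym.
by case: eqVneq => [->//|_]; rewrite weight_sym.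
Qed.

Lemma laplacian_trace_neq0 G :
  graph_connected G -> (1 < n)%N -> \tr (laplacian G) != 0.
Proof.
move=> Gc n1.
have w0 (i j : 'I_n) : j != i -> 0 <= weight G i j.
  move=> ji; have [/weight_gt0/ltW//|e] := boolP (edge G i j).
  by rewrite weight_eq0 // eq_sym.
pose i0 : 'I_n := Ordinal (ltnW n1); pose i1 : 'I_n := Ordinal n1.
have [j eij] : exists j, edge G i0 j.
  have /connectP[[|j p] /=] := Gc i0 i1; first by move=> _ /(congr1 val).
  by case/andP => e _ _; exists j.
have ji : j != i0.
  by apply/eqP => ji; move: eij; rewrite ji edge_irr.
rewrite gt_eqF// /mxtrace (bigD1 i0)//= ltr_wpDr//.
  apply: sumr_ge0 => i _; rewrite mxE eqxx.
  by apply: sumr_ge0 => k /w0.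
rewrite mxE eqxx (bigD1 j)//= ltr_wpDr ?weight_gt0//.
by apply: sumr_ge0 => k /andP[/w0].
Qed.

Lemma sym_nonzero_eigenvalue (A : 'M[R]_n) :
  A^T = A -> \tr A != 0 -> exists2 a, eigenvalue A a & a != 0.
Proof.
move=> AT trA.
have n0 : (0 < n)%N.
  case: n A AT trA => // A _ /eqP[]; by rewrite /mxtrace big_ord0.
pose f : R -> R[i] := real_complex R.
have [r Dp] := closed_field_poly_normal (map_poly f (char_poly A)).
have lc : lead_coef (map_poly f (char_poly A)) = 1.
  by rewrite lead_coef_map (eqP (char_poly_monic A)) rmorph1.
rewrite lc scale1r in Dp.
have [r0|] := boolP (all (pred1 0) r).
  have /all_pred1P rE := r0.
  have := congr1 (fun p : {poly R[i]} => p`_n.-1) Dp.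
  have sr : size r = n.
    have := congr1 (fun p : {poly R[i]} => size p) Dp.
    by rewrite size_map_poly size_char_poly size_prod_XsubC => -[].
  rewrite rE sr big_nseq subr0 iter_mulr_1 coefXn coef_map /= char_poly_trace//.
  rewrite -[n in _ == n]prednK// -[X in X == _]addn0 -addn1 eqn_add2l /=.
  move/eqP; rewrite rmorphN oppr_eq0 fmorph_eq0.
  by rewrite (negbTE trA).
move=> /allPn[/= c cr c0].
have : root (map_poly f (char_poly A)) c by rewrite Dp root_prod_XsubC.
rewrite map_char_poly -eigenvalue_root_char => /eigenvalueP[v vA v0].
have cc : c^*%C = c.
  pose vb : 'rV[R[i]]_n := map_mx (fun z => z^*%C) v.
  have vbA : vb *m map_mx f A = c^*%C *: vb.
    apply/rowP => j; have := congr1 (fun u : 'rV[R[i]]_n => (u 0 j)^*%C) vA.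
    rewrite !mxE rmorph_sum rmorphM /= => <-.
    by apply: eq_bigr => k _; rewrite !mxE rmorphM /= oppr0.
  have e : c *: (v *m vb^T) = c^*%C *: (v *m vb^T).
    have fAT : (map_mx f A)^T = map_mx f A by rewrite map_trmx AT.
    by rewrite scalemxAl -vA -mulmxA scalemxAr -linearZ /= -vbA trmx_mul fAT.
  have := congr1 (fun M : 'M[R[i]]_1 => M 0 0) e.
  rewrite [LHS]mxE [RHS]mxE => /esym; apply: mulIf; rewrite mxE.
  have p k : 0 <= v 0 k * vb^T k 0 by rewrite !mxE mul_conjC_ge0.
  rewrite psumr_eq0//; apply/negP => /allP h; case/eqP: v0.
  apply/rowP => k; have := h k (mem_index_enum _).
  by rewrite !mxE mulf_eq0 conjC_eq0 orbb => /eqP.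
have [a ca] : exists a, c = f a.
  exists (complex.Re c); case: c cc {cr c0 vA} => x y [] /eqP.
  by rewrite eqNr => /eqP ->.
exists a; last by move: c0; rewrite ca /= fmorph_eq0.
rewrite eigenvalue_root_char -(fmorph_root f) map_char_poly.
by rewrite -eigenvalue_root_char; apply/eigenvalueP; exists v; rewrite // vA ca.
Qed.

Lemma algebraic_connectivityP G :
  graph_connected G -> (1 < n)%N ->
  [/\ eigenvalue (laplacian G) (algebraic_connectivity G),
      algebraic_connectivity G != 0 &
      forall a, eigenvalue (laplacian G) a -> a != 0 ->
        algebraic_connectivity G <= a].
Proof.
move=> Gc n1; set L := laplacian G.
pose E := nonzero_eigenvalues G.
have [a La a0] :=
  sym_nonzero_eigenvalue (laplacian_sym G) (laplacian_trace_neq0 Gc n1).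
have [m Em mE] : exists2 m, E m & lbound E m.
  have EP b : reflect (E b) (b \in [seq c <- rootsR (char_poly L) | c != 0]).
    have := roots_on_rootsR (monic_neq0 (char_poly_monic L)) b.
    rewrite mem_filter -eigenvalue_root_char in_itv /= => <-.
    by apply: (iffP andP) => -[].
  have : sorted <=%R (sort <=%R [seq c <- rootsR (char_poly L) | c != 0]).
    exact/sort_sorted/le_total.
  have inS := mem_sort <=%R [seq c <- rootsR (char_poly L) | c != 0].
  case: sort inS => [|m t] inS; first by have /EP := conj La a0; rewrite -inS.
  move=> /(order_path_min le_trans)/allP mt; exists m.
    by apply/EP; rewrite -inS mem_head.
  by move=> b /EP; rewrite -inS inE => /predU1P[->//|/mt].
suff -> : algebraic_connectivity G = m.
  by case: Em => Lm m0; split=> // b Lb b0; apply: mE.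
apply/eqP; rewrite eq_le; apply/andP; split.
  by apply: ge_inf => //; exists m.
by apply: lb_le_inf => //; exists m.
Qed.

End WeightedGraph.

(* Main.v *)
(** The quadratic form [u L u^T] is half the sum of [w_ij (u_i - u_j)^2], so
    the kernel of [L] consists of the constants and, by the spectral theorem,
    [lambda_2 |x|^2 <= x L x^T] whenever [x] has zero sum. Take [x] equal to
    [1/N_1] on [X_1], to [-1/N_3] on [X_3] and to [0] on [X_2]: it has zero
    sum, [|x|^2 = 1/N_1 + 1/N_3], and only edges meeting [X_2] contribute to
    [x L x^T], at most [q N_2] of them and each by at most
    [w_max (1/N_1 + 1/N_3)^2]. Hence
    [lambda_2 <= q w_max (N_2/N_1 + N_2/N_3)]. *)
Require Import Defs.
From mathcomp Require Import all_boot all_order all_algebra.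
From mathcomp Require Import all_classical all_reals all_analysis.
From mathcomp Require Import complex spectral.
From mathcomp Require Import ring lra.
Import Order.TTheory GRing.Theory Num.Theory.
Import numFieldNormedType.Exports.
Local Open Scope classical_set_scope.
Local Open Scope ring_scope.
Local Open Scope sesquilinear_scope.

(** * Rayleigh bound for real symmetric matrices *)

(** Expand [x] in an orthonormal eigenbasis of [A] over [R[i]]. Coordinates for the eigenvalue 0
    vanish because [x] is orthogonal to the real kernel; every other eigenvalue is at least [m]. *)
Lemma eigenvalue_le_rayleigh (R : realType) n (A : 'M[R]_n) (m : R)
    (x : 'rV[R]_n) :
  A^T = A -> (forall a, eigenvalue A a -> a != 0 -> m <= a) ->
  (forall u : 'rV[R]_n, u *m A = 0 -> x *m u^T = 0) ->
  m * (x *m x^T) 0 0 <= (x *m A *m x^T) 0 0.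
Proof.
move=> AT mA xker.
pose f : {rmorphism R -> R[i]} := real_complex R.
have fC a : (f a)^* = f a by exact: conjc_real.
set B := map_mx f A.
have Breal : B \is a mxOver Num.real.
  by apply/mxOverP => i j; rewrite mxE; apply/CrealP; apply: fC.
have Bherm : B \is hermsymmx.
  by apply: realsym_hermsym => //; apply/is_hermitianmxP;
    rewrite expr0 scale1r map_mx_id // map_trmx AT.
have /orthomx_spectralP := hermitian_normalmx Bherm.
have /mxOverP := hermitian_spectral_diag_real Bherm.
have := spectral_unitarymx B.
set P := spectralmx B; set d := spectral_diag B => Pu dreal.
rewrite (invmx_unitary Pu) => BE.
(* The rows of [P] form the eigenbasis, and [y] lists the coordinates of [x] in it. *)
pose X := map_mx f x; pose y := X *m P^t*.
have yC i : (P *m X^T) i 0 = (y 0 i)^*.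
  rewrite !mxE rmorph_sum; apply: eq_bigr => j _.
  by rewrite !mxE rmorphM /= conjCK fC mulrC.
have XX : f ((x *m x^T) 0 0) = \sum_i y 0 i * (y 0 i)^*.
  have -> : f ((x *m x^T) 0 0) = (X *m X^T) 0 0.
    by rewrite map_trmx -map_mxM !mxE.
  rewrite -{1}(mulmxKtV X Pu erefl) -!mulmxA mulmxA -/y mxE.
  by apply: eq_bigr => i _; rewrite yC.
have XBX : f ((x *m A *m x^T) 0 0) = \sum_i d 0 i * (y 0 i * (y 0 i)^*).
  have -> : f ((x *m A *m x^T) 0 0) = (X *m B *m X^T) 0 0.
    by rewrite map_trmx -!map_mxM !mxE.
  rewrite BE !mulmxA -/y -mulmxA mxE; apply: eq_bigr => i _.
  by rewrite yC mul_mx_diag mxE mulrA [d 0 i * _]mulrC.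
rewrite -lecR rmorphM /= XX XBX mulr_sumr; apply: ler_sum => i _.
have yy : 0 <= y 0 i * (y 0 i)^* by rewrite mul_conjC_ge0.
have vB : row i P *m B = d 0 i *: row i P.
  rewrite -row_mul BE !mulmxA (unitarymxP Pu) mul1mx.
  by apply/rowP => j; rewrite mxE mul_diag_mx !mxE.
have /complex_realP[a da] : d 0 i \is Num.real by [].
rewrite da in vB *.
(* The diagonal entries of [P *m P^t*] are 1, so no row of [P] is zero. *)
have v0 : row i P != 0.
  apply: contraTneq (oner_neq0 R[i]) => v0.
  have := congr1 (fun M : 'M[R[i]]_n => M i i) (unitarymxP Pu).
  rewrite !mxE eqxx /= big1 => [->|j _]; first by rewrite eqxx.
  by have /rowP/(_ j) := v0; rewrite !mxE => ->; rewrite mul0r.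
have [a0|a0] := eqVneq a 0; last first.
  rewrite ler_wpM2r // lecR mA //.
  (* The embedding [f] reflects roots of the characteristic polynomial, so [a] is an eigenvalue over
     [R] too. *)
  rewrite eigenvalue_root_char -(fmorph_root f) map_char_poly.
  by rewrite -eigenvalue_root_char; apply/eigenvalueP; exists (row i P).
rewrite {}a0 scale0r in vB.
suff -> : y 0 i = 0 by rewrite mul0r !mulr0.
(* The null vector [row i P] may be complex. As [A] is real, its real and imaginary parts [g] and
   [h] both lie in the real kernel, to which [x] is orthogonal. *)
pose g := map_mx (fun z : R[i] => complex.Re z) (row i P).
pose h := map_mx (fun z : R[i] => complex.Im z) (row i P).
have vE : row i P = map_mx f g + 'i%C *: map_mx f h.
  by apply/rowP => j; rewrite !mxE -complexE.
have vM k (M : 'M[R]_(n, k)) :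
    row i P *m map_mx f M = map_mx f (g *m M) + 'i%C *: map_mx f (h *m M).
  by rewrite vE mulmxDl -scalemxAl -!map_mxM.
have [gA hA] : g *m A = 0 /\ h *m A = 0.
  by split; apply/rowP => j; move: vB; rewrite vM => /rowP/(_ j);
    rewrite !mxE => /eqP; rewrite eq_complex /=; simpc => /andP[/eqP ? /eqP ?].
have xu (u : 'rV_n) : u *m A = 0 -> u *m x^T = 0.
  by move=> uA; rewrite -[LHS]trmxK trmx_mul trmxK xker // trmx0.
apply/eqP; rewrite -conjC_eq0 -yC.
have -> : (P *m X^T) i 0 = (row i P *m map_mx f x^T) 0 0.
  by rewrite -row_mul [RHS]mxE map_trmx.
by rewrite vM !xu// map_mx0 scaler0 addr0 mxE.
Qed.

(** * Quadratic form and kernel of the Laplacian *)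

Section Laplacian.
Variables (R : realType) (n : nat) (G : wgraph R n).
Implicit Type u : 'rV[R]_n.

Lemma weight_ge0 i j : i != j -> 0 <= weight G i j.
Proof.
move=> ij; have [/weight_gt0/ltW//|e] := boolP (edge G i j).
by rewrite weight_eq0.
Qed.

(** On the diagonal the weight is unspecified, but the difference is zero. *)
Lemma dirichlet_term_ge0 u i j : 0 <= weight G i j * (u 0 i - u 0 j) ^+ 2.
Proof.
have [->|/weight_ge0 w0] := eqVneq i j; first by rewrite subrr expr0n mulr0.
by rewrite mulr_ge0 ?sqr_ge0.
Qed.

(** Summing over all [k] makes the formula uniform in [i] and [j]: the unspecified [weight G i i]
    cancels. *)
Lemma laplacianE i j :
  laplacian G i j = (i == j)%:R * (\sum_k weight G i k) - weight G i j.
Proof.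
rewrite mxE; case: eqVneq => [<-|_]; last by rewrite mul0r sub0r.
by rewrite mul1r [in RHS](bigD1 i)//= addrC addrK.
Qed.

Lemma laplacian_form u :
  (u *m laplacian G *m u^T) 0 0 *+ 2
  = \sum_i \sum_j weight G i j * (u 0 i - u 0 j) ^+ 2.
Proof.
have E : (u *m laplacian G *m u^T) 0 0
    = \sum_i \sum_j weight G i j * (u 0 i ^+ 2 - u 0 i * u 0 j).
  rewrite mxE.
  under eq_bigr do rewrite !mxE mulr_suml.
  rewrite exchange_big /=; apply: eq_bigr => i _.
  under [RHS]eq_bigr do rewrite mulrBr.
  rewrite sumrB -mulr_suml.
  under eq_bigr do rewrite laplacianE mulrBr mulrBl.
  rewrite sumrB; congr (_ - _); last by apply: eq_bigr => j _; ring.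
  rewrite (bigD1 i)//= eqxx mul1r [X in _ + X]big1 ?addr0.
    by rewrite mulrAC mulrC expr2.
  by move=> j ji; rewrite eq_sym (negbTE ji) mul0r mulr0 mul0r.
(* Adding the copy with [i] and [j] exchanged completes the square. *)
rewrite mulr2n {2}E exchange_big E -big_split /=; apply: eq_bigr => i _.
rewrite -big_split /=; apply: eq_bigr => j _.
by rewrite (weight_sym G j i); ring.
Qed.

Lemma laplacian_form_ge0 u : 0 <= (u *m laplacian G *m u^T) 0 0.
Proof.
rewrite -(pmulrn_lge0 _ (ltn0Sn 1)) laplacian_form.
by apply: sumr_ge0 => i _; apply: sumr_ge0 => j _; apply: dirichlet_term_ge0.
Qed.

(** An eigenvector [v] satisfies [a * |v|^2 = v L v^T >= 0] with [|v|^2 > 0]. *)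
Lemma laplacian_eigenvalue_ge0 a : eigenvalue (laplacian G) a -> 0 <= a.
Proof.
move=> /eigenvalueP[v vL v0].
have := laplacian_form_ge0 v; rewrite vL -scalemxAl mxE.
rewrite pmulr_lge0 // mxE lt_def; apply/andP; split; last first.
  by apply: sumr_ge0 => i _; rewrite mxE -expr2 sqr_ge0.
apply: contra_neq v0 => /eqP; rewrite psumr_eq0; last first.
  by move=> i _; rewrite mxE -expr2 sqr_ge0.
move=> /allP h; apply/rowP => i; have := h i (mem_index_enum _).
by rewrite !mxE mulf_eq0 orbb => /eqP.
Qed.

(** The form vanishes at [u], hence so does each of its nonnegative terms; [u] is then constant
    across every edge and along every path. *)
Lemma laplacian_kernel u : graph_connected G -> u *m laplacian G = 0 ->
  forall i j, u 0 i = u 0 j.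
Proof.
move=> Gc uL i j.
have eq_edge k l : edge G k l -> u 0 k = u 0 l.
  move=> kl; have /esym/eqP := laplacian_form u.
  have ge0 := dirichlet_term_ge0 u.
  rewrite uL mul0mx mxE mul0rn psumr_eq0; last by move=> *; apply: sumr_ge0.
  move=> /allP/(_ k (mem_index_enum _)); rewrite psumr_eq0//.
  move=> /allP/(_ l (mem_index_enum _)).
  by rewrite /= mulf_eq0 (gt_eqF (weight_gt0 kl))/= sqrf_eq0 subr_eq0 => /eqP.
have /connectP[p] := Gc i j.
elim: p i => [|k p IH] i /=; first by move=> _ ->.
by case/andP => /eq_edge -> /IH h /h.
Qed.

Lemma algebraic_connectivity_ge0 :
  graph_connected G -> (1 < n)%N -> 0 <= algebraic_connectivity G.
Proof.
move=> Gc n1.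
by have [/laplacian_eigenvalue_ge0] := algebraic_connectivityP Gc n1.
Qed.

End Laplacian.

Lemma sum_mem_set (R : nzSemiRingType) (T : finType) (A : {set T}) :
  \sum_i (i \in A)%:R = #|A|%:R :> R.
Proof.
rewrite -sum1_card natr_sum [RHS]big_mkcond.
by apply: eq_bigr => i _; case: (i \in A).
Qed.

(** * The test vector of a separating set *)

Section SeparatingSet.
Variables (R : realType) (n : nat) (G : wgraph R n).
Variables (q : nat) (wmax : R) (X1 X2 X3 : {set 'I_n}).
Hypothesis Gconn : graph_connected G.
Hypothesis wmax_ge0 : 0 <= wmax.
Hypothesis Gdeg : forall i, (#|neighbors G i| <= q)%N.
Hypothesis Gweight : forall i j, edge G i j -> weight G i j <= wmax.
Hypotheses (X1_gt0 : (0 < #|X1|)%N) (X3_gt0 : (0 < #|X3|)%N).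
Hypothesis X13_disj : [disjoint X1 & X3]%B.
Hypothesis X_cover : (X1 :|: X2 :|: X3 = [set: 'I_n])%SET.
Hypothesis X13_noedge : forall i j, i \in X1 -> j \in X3 -> ~~ edge G i j.

Let a : R := #|X1|%:R^-1.
Let b : R := #|X3|%:R^-1.

Definition separation_vector : 'rV[R]_n :=
  \row_i ((i \in X1)%:R * a - (i \in X3)%:R * b).

Let x := separation_vector.

Let a_gt0 : 0 < a. Proof. by rewrite invr_gt0 ltr0n. Qed.
Let b_gt0 : 0 < b. Proof. by rewrite invr_gt0 ltr0n. Qed.

Let notin_X13 i : i \in X1 -> i \in X3 -> False.
Proof. by move=> i1 i3; have := disjointFr X13_disj i1; rewrite i3. Qed.

(** Each normalized indicator sums to 1. Zero sum gives orthogonality to the constants. *)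
Lemma separation_vector_sum : \sum_i x 0 i = 0.
Proof.
under eq_bigr do rewrite mxE.
rewrite sumrB -!mulr_suml !sum_mem_set.
by rewrite !mulfV ?subrr // pnatr_eq0 -lt0n.
Qed.

Lemma separation_vector_norm : (x *m x^T) 0 0 = a + b.
Proof.
have -> : (x *m x^T) 0 0
    = \sum_i ((i \in X1)%:R * a ^+ 2 + (i \in X3)%:R * b ^+ 2).
  rewrite mxE; apply: eq_bigr => i _; rewrite !mxE.
  by case i1: (i \in X1); case i3: (i \in X3) => /=;
    [case: (notin_X13 i i1 i3)|ring..].
rewrite big_split /= -!mulr_suml !sum_mem_set /= !expr2 !mulrA.
by rewrite !mulfV ?mul1r // pnatr_eq0 -lt0n.
Qed.

Lemma separation_vector_form :
  (x *m laplacian G *m x^T) 0 0 <= (#|X2| * q)%:R * wmax * (a + b) ^+ 2.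
Proof.
(* Ordered pairs are counted: each node of [X2] starts at most [q] edges. *)
have count : \sum_i \sum_j ((i \in X2) && edge G i j)%:R <= (#|X2| * q)%:R :> R.
  rewrite natrM -sum_mem_set mulr_suml; apply: ler_sum => i _.
  case: (i \in X2) => /=; last by rewrite big1 // mul0r.
  suff -> : \sum_j (edge G i j)%:R = #|neighbors G i|%:R :> R.
    by rewrite mul1r ler_nat.
  by rewrite -sum_mem_set; apply: eq_bigr => j _; rewrite inE.
rewrite -(ler_pMn2r (ltn0Sn 1)) laplacian_form -mulrA -mulrnAl.
pose c := wmax * (a + b) ^+ 2.
have c0 : 0 <= c by rewrite mulr_ge0 ?sqr_ge0.
(* Each ordered edge is charged [c] for every end it has in [X2]. *)
apply: (@le_trans _ _ (\sum_i \sum_j (((i \in X2) && edge G i j)%:R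
    + ((j \in X2) && edge G j i)%:R) * c)).
  apply: ler_sum => i _; apply: ler_sum => j _.
  have [<-|ij] := eqVneq i j.
    by rewrite subrr expr0n mulr0 edge_irr !andbF addr0 mul0r.
  rewrite [edge G j i]edge_sym.
  have [eij|/(weight_eq0 ij) ->] := boolP (edge G i j); last first.
    by rewrite !andbF addr0 !mul0r.
  have w0 := weight_gt0 eij; have wm := Gweight i j eij.
  have [i2|] := boolP ((i \in X2) || (j \in X2)); last first.
    rewrite negb_or => /andP[i2 j2].
    (* Off [X2], the sets [X1] and [X3] are complementary, so an edge avoiding [X2] stays on one
       side and [x] agrees at its ends. *)
    have cover k : k \notin X2 -> (k \in X1) = (k \notin X3).
      move=> k2; have /setP/(_ k) := X_cover; rewrite !inE (negbTE k2) orbF.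
      by case k1: (k \in X1); case k3: (k \in X3) => //; case: (notin_X13 k).
    have -> : x 0 i = x 0 j.
      have eji : edge G j i by rewrite edge_sym.
      have := X13_noedge i j; have := X13_noedge j i; rewrite !mxE eij eji.
      rewrite !cover //; case: (i \in X3); case: (j \in X3) => //=.
        by move/(_ isT isT).
      by move=> _ /(_ isT isT).
    by rewrite subrr expr0n mulr0 mulr_ge0 ?addr_ge0.
  apply: (@le_trans _ _ c).
    apply: ler_pM; rewrite ?sqr_ge0 ?(ltW w0) //.
    (* Entries in [[-b, a]] differ by at most [a + b]. *)
    have xb k : - b <= x 0 k <= a.
      have [a0 b0] := (a_gt0, b_gt0); rewrite mxE.
      case: (k \in X1); case: (k \in X3) => /=; lra.
    have /andP[? ?] := xb i; have /andP[? ?] := xb j.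
    by rewrite -subr_ge0 subr_sqr mulr_ge0//; lra.
  rewrite ler_peMl // -natrD ler1n !andbT.
  by case/orP: i2 => ->; rewrite ?addn1 ?add1n.
under eq_bigr do rewrite -mulr_suml big_split /=.
(* Exchanging the indices identifies the two sums, giving the factor 2 of [laplacian_form]. *)
rewrite -mulr_suml big_split /= [X in _ + X]exchange_big -mulr2n.
by rewrite ler_wpM2r ?lerMn2r ?count ?orbT.
Qed.

Lemma disjoint_gt1 : (1 < n)%N.
Proof.
rewrite -[n in (_ < n)%N]card_ord; have /card_gt0P[i i1] := X1_gt0.
have /card_gt0P[j j3] := X3_gt0; apply/card_gt1P; exists i, j; split=> //.
by apply: contraTneq j3 => <-; rewrite (disjointFr X13_disj).
Qed.

Lemma algebraic_connectivity_le :
  algebraic_connectivity G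
    <= q%:R * wmax * (#|X2|%:R / #|X1|%:R + #|X2|%:R / #|X3|%:R).
Proof.
have [_ _ min] := algebraic_connectivityP Gconn disjoint_gt1.
set l := algebraic_connectivity G in min *.
have xker (u : 'rV_n) : u *m laplacian G = 0 -> x *m u^T = 0.
  move=> /(laplacian_kernel R n G u Gconn) uc.
  have /card_gt0P[i0 _] := X1_gt0.
  apply/matrixP => i j; rewrite !ord1 mxE.
  under eq_bigr => k _ do rewrite [u^T k 0]mxE (uc k i0).
  by rewrite -mulr_suml separation_vector_sum mxE mul0r.
have := eigenvalue_le_rayleigh R n _ l x (laplacian_sym G) min xker.
rewrite separation_vector_norm => /le_trans/(_ separation_vector_form) h.
(* The norm [a + b] cancels one factor of [(a + b) ^+ 2]. *)
rewrite -(ler_pM2r (addr_gt0 a_gt0 b_gt0)); apply: le_trans h _.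
by rewrite -/a -/b -mulrDr natrM le_eqVlt; apply/predU1P; left; ring.
Qed.

End SeparatingSet.

Theorem lemma3p1 (R : realType) (N : nat -> nat)
    (G : forall k : nat, wgraph R (N k))
    (q : nat) (wmin wmax : R)
    (X1 X2 X3 : forall k : nat, {set 'I_(N k)})
    (N_incr : forall k l : nat, (k <= l)%N -> (N k <= N l)%N)
    (N_infty : N @ \oo --> \oo)
    (Gconn : forall k, graph_connected (G k))
    (wmin_gt0 : 0 < wmin) (wmin_le_wmax : wmin <= wmax)
    (Gdeg : forall k (i : 'I_(N k)), (#|neighbors (G k) i| <= q)%N)
    (Gweight : forall k (i j : 'I_(N k)), edge (G k) i j ->
       wmin <= weight (G k) i j /\ weight (G k) i j <= wmax)
    (X1_gt0 : forall k, (0 < #|X1 k|)%N)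
    (X3_gt0 : forall k, (0 < #|X3 k|)%N)
    (X12_disj : forall k, [disjoint X1 k & X2 k]%B)
    (X13_disj : forall k, [disjoint X1 k & X3 k]%B)
    (X23_disj : forall k, [disjoint X2 k & X3 k]%B)
    (X_cover : forall k, (X1 k :|: X2 k :|: X3 k = [set: 'I_(N k)])%SET)
    (X2_adj : forall k (i : 'I_(N k)), i \in X2 k ->
       (exists2 j, j \in X1 k & edge (G k) i j) /\
       (exists2 j, j \in X3 k & edge (G k) i j))
    (X13_noedge : forall k (i j : 'I_(N k)),
       i \in X1 k -> j \in X3 k -> ~~ edge (G k) i j)
    (X21_ratio : (#|X2 k|%:R / #|X1 k|%:R : R) @[k --> \oo] --> (0 : R))
    (X23_ratio : (#|X2 k|%:R / #|X3 k|%:R : R) @[k --> \oo] --> (0 : R)) :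
  algebraic_connectivity (G k) @[k --> \oo] --> (0 : R).
Proof.
have wmax_ge0 : 0 <= wmax by rewrite (le_trans (ltW wmin_gt0)).
pose ub k : R := q%:R * wmax *
  (#|X2 k|%:R / #|X1 k|%:R + #|X2 k|%:R / #|X3 k|%:R).
have ub0 : ub k @[k --> \oo] --> (0 : R).
  rewrite -(mulr0 (q%:R * wmax)) -[X in _ * X]addr0.
  by apply: cvgMr; apply: cvgD.
(* The connectivity is squeezed between 0 and [ub], for every [k]. *)
apply: (@squeeze_cvgr _ _ _ _ (fun=> 0) ub) => //; last exact: cvg_cst.
apply: nearW => k; apply/andP; split.
  by apply: algebraic_connectivity_ge0 => //;
    apply: (disjoint_gt1 _ (X1 k) (X3 k)).
apply: algebraic_connectivity_le => // i j.
  by move=> eij; have [] := Gweight k i j eij.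
exact: X13_noedge.
Qed.
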